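(* There exists an absolute constant $c>0$ such that the following holds. Let $N\ge 2$ be an integer and let $A\in\mathbb{R}^{N\times N}$ be a real matrix of rank $n$ such that $$\max_{1\le i,j\le N}|A_{i,j}-\delta_{i,j}|\le \frac13 .$$ Then the proportion of nonzero entries of $A$ satisfies $$\frac{|\{(i,j)\in\{1,\dots,N\}^2\colon A_{i,j}\ne 0\}|}{N^2}\;\ge\; c\,\frac{\log N}{n\,\log\!\left(2+\frac{n}{\log N}\right)} .$$
   Context: $\delta_{i,j}$ is the Kronecker delta (the entries of the identity matrix). ''Absolute constant'' means that $c$ does not depend on $N$, $n$ or $A$. $\log$ is the natural logarithm (the choice of base affects only the constant $c$). *)

(* Defs.v *)
From mathcomp Require Import all_boot all_order all_algebra.
From mathcomp Require Import all_classical all_reals all_analysis.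

Set Implicit Arguments.
Unset Strict Implicit.
Unset Printing Implicit Defensive.

Import GRing.Theory Num.Theory.
Local Open Scope ring_scope.

Definition nonzero_density (R : realType) (N : nat) (A : 'M[R]_N) : R :=
  #|[set ij : 'I_N * 'I_N | A ij.1 ij.2 != 0]|%:R / N%:R ^+ 2.

(* Main.v *)
Require Import Defs.
From mathcomp Require Import all_boot all_order all_algebra.
From mathcomp Require Import all_classical all_reals all_analysis.
From mathcomp Require Import ring lra zify.
(* Restores the finite-set names shadowed by [classical_sets]. *)
From mathcomp Require Import fintype finset.

(* Keep the rows with at most twice the average number of nonzero entries, and
   among their indices choose S maximizing |S| / d, where d is the rank of the
   columns of S, so that every subspace of dimension e contains at most
   e |S| / d of these columns. If k columns of S are drawn at random, the
   codimension X of their span behaves as in the coupon collector problem: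
   X >= r has probability at most C(d, r) (1 - r/d)^k. A row with at most s
   nonzero entries vanishes on all drawn columns with probability at least
   (1 - s/|S|)^k. If s is too small, there is a choice for which X < r while
   at least 16^r rows of S vanish on the drawn columns. The principal
   submatrix of A on these rows is close to the identity and has rank at most
   X, contradicting Alon's bound: by diagonal dominance, the entrywise power of
   order k of a near-identity matrix of size at most 2^k is nonsingular, whereas
   its rank is at most (3/2)^k 3^r for a matrix of rank r. *)

Set Implicit Arguments.
Unset Strict Implicit.
Unset Printing Implicit Defensive.

Import Order.TTheory GRing.Theory Num.Theory.
Local Open Scope ring_scope.

(** * Rank of near-identity matrices *)

Lemma mxrank_sum_leq (F : fieldType) (m n : nat) (I : Type) (s : seq I)
    (B : I -> 'M[F]_(m, n)) :
  (\rank (\sum_(i <- s) B i)%R <= \sum_(i <- s) \rank (B i))%N.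
Proof.
elim/big_rec2: _ => [|i r C _ leCr]; first by rewrite mxrank0.
by apply: leq_trans (mxrank_add _ _) _; rewrite leq_add2l.
Qed.

Lemma mxrank_hadamard_rank1 (F : fieldType) (m n : nat) (u : 'I_m -> F)
    (v : 'I_n -> F) (C : 'M[F]_(m, n)) :
  (\rank (\matrix_(i, j) (u i * v j * C i j)%R) <= \rank C)%N.
Proof.
have -> : \matrix_(i, j) (u i * v j * C i j) =
    diag_mx (\row_(i < m) u i) *m C *m diag_mx (\row_(j < n) v j).
  by apply/matrixP=> i j; rewrite mul_mx_diag mul_diag_mx !mxE mulrAC.
by apply: leq_trans (mxrankM_maxl _ _) (mxrankM_maxr _ _).
Qed.


(** Induction on [r]: split off one rank-one term of the product and expand the power by the
    binomial theorem. Each summand is a row and column rescaling of a lower power of the remaining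
    product, so its rank does not grow. *)
Lemma mxrank_hadamard_exp (F : fieldType) (m n r : nat) (U : 'M[F]_(m, r))
    (V : 'M[F]_(r, n)) (k : nat) :
  (2 ^ k * \rank (map_mx (fun x => x ^+ k) (U *m V)) <= 3 ^ (k + r))%N.
Proof.
elim: r U V k => [|r IHr] U V k.
  (* The power of order 0 is the all-ones matrix, since [0 ^+ 0 = 1]; every higher power of the
     empty product is zero. *)
  case: k => [|k].
    rewrite expn0 mul1n.
    have -> : map_mx (fun x => x ^+ 0) (U *m V) =
        (const_mx 1 : 'M[F]_(m, 1)) *m (const_mx 1 : 'M[F]_(1, n)).
      by apply/matrixP=> i j; rewrite !mxE big_ord1 !mxE mulr1.
    by apply: leq_trans (mxrankM_maxl _ _) (rank_leq_col _).
  have -> : map_mx (fun x => x ^+ k.+1) (U *m V) = 0.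
    by apply/matrixP=> i j; rewrite !mxE big_ord0 expr0n.
  by rewrite mxrank0 muln0.
pose U' : 'M[F]_(m, r) := \matrix_(i, j) U i (lift ord0 j).
pose V' : 'M[F]_(r, n) := \matrix_(i, j) V (lift ord0 i) j.
pose H j := map_mx (fun x => x ^+ j) (U' *m V').
have -> : map_mx (fun x => x ^+ k) (U *m V) = \sum_(l < k.+1)
    \matrix_(i, j) ((U i ord0 ^+ l *+ 'C(k, l)) * V ord0 j ^+ l * H (k - l)%N i j).
  apply/matrixP=> i j; rewrite summxE !mxE big_ord_recl addrC exprDn.
  apply: eq_bigr => l _; rewrite !mxE exprMn mulrnAl mulrnAl [_ ^+ (k - l) * _]mulrC.
  by congr (_ * _ ^+ _ *+ _); apply: eq_bigr => t _; rewrite !mxE.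
apply: (@leq_trans (\sum_(l < k.+1) 2 ^ l * 3 ^ (k - l) * 3 ^ r)).
  apply: leq_trans (leq_mul (leqnn _) (mxrank_sum_leq _ _)) _.
  rewrite big_distrr /=; apply: leq_sum => l _.
  have lk : (l <= k)%N by rewrite -ltnS.
  rewrite -{1}(subnKC lk) expnD -!mulnA leq_mul2l -expnD; apply/orP; right.
  exact: leq_trans (leq_mul (leqnn _) (mxrank_hadamard_rank1 _ _ _)) (IHr _ _ _).
rewrite -big_distrl /= addnS -addSn expnD leq_mul2r; apply/orP; right.
(* The weights 2 and 3 differ by 1, so the geometric sum telescopes without a denominator. *)
rewrite (_ : \sum_(l < k.+1) _ = 3 ^ k.+1 - 2 ^ k.+1)%N ?leq_subr //.
by rewrite subn_exp mul1n; apply: eq_bigr => l _; rewrite mulnC.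
Qed.

(** A nonzero vector of the left kernel, read at a coordinate of largest modulus, would force
    [a <= m.-1%:R * b]. *)
Lemma diag_dominant_mxrank (R : realFieldType) (m : nat) (B : 'M[R]_m) (a b : R) :
  (forall i, a <= `|B i i|) -> (forall i j, i != j -> `|B i j| <= b) ->
  0 <= b -> m.-1%:R * b < a -> \rank B = m.
Proof.
move=> diagB offB b0 ltba; apply/eqP; rewrite -[_ == _]/(row_free B).
rewrite -kermx_eq0; apply/rowV0P => w /sub_kermxP wB.
case: m => [|m] in B w a b diagB offB b0 ltba wB *; first by rewrite thinmx0.
pose i := [arg max_(i > ord0) `|w 0 i|]%O.
have wi j : `|w 0 j| <= `|w 0 i|.
  by rewrite /i; case: arg_maxP => //= l _; apply.
suff: `|w 0 i| = 0.
  move=> wi0; apply/rowP => j; apply/eqP; rewrite mxE -normr_eq0.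
  by rewrite eq_le normr_ge0 andbT -wi0.
apply/eqP; apply: contraT => wi_neq0.
have wi_gt0 : 0 < `|w 0 i| by rewrite lt_def wi_neq0 normr_ge0.
have /rowP/(_ i) := wB; rewrite !mxE (bigD1 i) //= => /eqP.
rewrite addr_eq0 => /eqP/(congr1 Num.norm); rewrite normrN normrM => wBi.
suff: `|w 0 i| * a <= `|w 0 i| * (m%:R * b) by rewrite ler_pM2l // leNgt ltba.
apply: le_trans (_ : `|w 0 i| * `|B i i| <= _); first by rewrite ler_pM2l.
rewrite wBi; apply: le_trans (ler_norm_sum _ _ _) _.
apply: le_trans (_ : \sum_(j | j != i) `|w 0 i| * b <= _).
  by apply: ler_sum => j ji; rewrite normrM ler_pM // offB.
rewrite sumr_const cardC1 card_ord.
by rewrite -mulrnAr -[b *+ _]mulr_natl.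
Qed.

(** On exactly 16^r indices the entrywise power of order 4r is diagonally dominant, (2/3)^(4r)
    against (16^r - 1)(1/3)^(4r), hence of full rank. The rank bound for powers would then give
    256^r <= 243^r. *)
Lemma near_identity_size_lt (R : realFieldType) (m r : nat) (B : 'M[R]_m) :
  (forall i j, `|B i j - (i == j)%:R| <= 1 / 3) ->
  (\rank B <= r)%N -> (0 < r)%N -> (m < 16 ^ r)%N.
Proof.
move=> nearB rkB r0; rewrite ltnNge; apply/negP => le_m.
pose f : 'I_(16 ^ r) -> 'I_m := widen_ord le_m.
pose C := mxsub f f B.
have rkC : (\rank C <= r)%N.
  apply: leq_trans rkB; rewrite /C -[B in mxsub _ _ B]mulmx1 mxsub_mul.
  apply: leq_trans (mxrankM_maxl _ _) _.
  by rewrite rowsubE; apply: mxrankM_maxr.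
have nearC i j : `|C i j - (i == j)%:R| <= 1 / 3.
  have := nearB (f i) (f j).
  by rewrite mxE -[f i == f j]/(i == j).
have := mxrank_hadamard_exp (col_base C) (row_base C) (4 * r).
rewrite mulmx_base (@diag_dominant_mxrank _ _ _ ((2 / 3) ^+ (4 * r)) ((1 / 3) ^+ (4 * r))).
- apply/negP; rewrite -ltnNge.
  apply: leq_ltn_trans (_ : (3 ^ (4 * r + r) < _)%N); first by rewrite leq_pexp2l // leq_add2l.
  by rewrite -mulSnr !expnM -expnMn ltn_exp2r.
- move=> i; rewrite mxE normrX lerXn2r ?nnegrE //.
  have := nearC i i; rewrite eqxx mulr1n ler_norml => /andP[h _].
  by apply: le_trans (ler_norm _); lra.
- move=> i j ij; rewrite mxE normrX lerXn2r ?nnegrE //.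
  by have := nearC i j; rewrite (negbTE ij) subr0.
- by apply: exprn_ge0; lra.
- rewrite !expr_div_n expr1n mulrA mulr1 ltr_pM2r ?invr_gt0 ?exprn_gt0 //.
  by rewrite -natrX ltr_nat expnM prednK ?expn_gt0.
Qed.

(** * Balanced sets of columns *)

(** Subspaces are row spaces here, so columns are transposed; [<<_>>] makes each a square matrix, so
    that they can be summed as subspaces. *)
Definition col_span (F : fieldType) (m n : nat) (A : 'M[F]_(m, n))
    (J : {set 'I_n}) : 'M[F]_m :=
  (\sum_(j in J) <<(col j A)^T>>)%MS.

Lemma col_spanS (F : fieldType) (m n : nat) (A : 'M[F]_(m, n)) (J K : {set 'I_n}) :
  J \subset K -> (col_span A J <= col_span A K)%MS.
Proof.
move=> /subsetP sJK; apply/sumsmx_subP => j jJ.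
exact: (sumsmx_sup j (sJK _ jJ)).
Qed.

Lemma mem_col_span (F : fieldType) (m n : nat) (A : 'M[F]_(m, n)) (J : {set 'I_n}) j :
  j \in J -> ((col j A)^T <= col_span A J)%MS.
Proof. by move=> jJ; apply: (sumsmx_sup j jJ); rewrite genmxE. Qed.

Lemma col_span_sub (F : fieldType) (m n p : nat) (A : 'M[F]_(m, n)) (J : {set 'I_n})
    (B : 'M[F]_(p, m)) :
  (forall j, j \in J -> ((col j A)^T <= B)%MS) -> (col_span A J <= B)%MS.
Proof. by move=> sub; apply/sumsmx_subP => j jJ; rewrite genmxE sub. Qed.

Lemma mxrank_col_span_le (F : fieldType) (m n : nat) (A : 'M[F]_(m, n)) (J : {set 'I_n}) :
  (\rank (col_span A J) <= \rank A)%N.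
Proof.
rewrite -(mxrank_tr A); apply: mxrankS; apply: col_span_sub => j _.
by rewrite tr_col row_sub.
Qed.

(** Rank-nullity for the projection [P] to the coordinates [f], restricted to the span of [K]: its
    kernel contains the span of [J], and its image contains the columns of the submatrix. *)
Lemma mxrank_zero_block (F : fieldType) (m n k l : nat) (A : 'M[F]_(m, n))
    (J K : {set 'I_n}) (f : 'I_k -> 'I_m) (g : 'I_l -> 'I_n) :
  J \subset K -> (forall t, g t \in K) ->
  (forall t j, j \in J -> A (f t) j = 0) ->
  (\rank (mxsub f g A) + \rank (col_span A J) <= \rank (col_span A K))%N.
Proof.
move=> sJK gK A0.
pose P : 'M[F]_(m, k) := colsub f 1%:M.
have colP j t : ((col j A)^T *m P) 0 t = A (f t) j.
  by rewrite -[(col j A)^T]mxsub_id mulmx_colsub mulmx1 !mxE.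
rewrite -(mxrank_mul_ker (col_span A K) P) leq_add //.
  rewrite -mxrank_tr; apply: mxrankS; apply/row_subP => t.
  apply: (@submx_trans _ _ _ _ _ _ ((col (g t) A)^T *m P)).
    suff -> : row t (mxsub f g A)^T = (col (g t) A)^T *m P by [].
    by apply/rowP => u; rewrite colP !mxE.
  by apply/submxMr/mem_col_span.
apply: mxrankS; rewrite sub_capmx col_spanS //=.
apply: col_span_sub => j jJ; apply/sub_kermxP/rowP => t.
by rewrite colP A0 // mxE.
Qed.

Lemma mxrank_col_span_add (F : fieldType) (m n : nat) (A : 'M[F]_(m, n))
    (J : {set 'I_n}) (j : 'I_n) :
  ~~ ((col j A)^T <= col_span A J)%MS ->
  (\rank (col_span A J) < \rank (col_span A (j |: J)))%N.
Proof.
move=> jJ; apply: rank_ltmx => /=; rewrite ltmxE col_spanS ?subsetUr //=.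
by apply: contra jJ; apply: submx_trans; rewrite mem_col_span // !inE eqxx.
Qed.

(** Cross-multiplied: a uniformly random column of [S] falls in [T] with probability at most the
    ratio of the two ranks. *)
Definition rank_balanced (F : fieldType) (m n : nat) (A : 'M[F]_(m, n))
    (S : {set 'I_n}) : Prop :=
  forall T : {set 'I_n}, T \subset S ->
    (#|T| * \rank (col_span A S) <= \rank (col_span A T) * #|S|)%N.

(** Maximality of [dens] at [S] gives balance against subsets of [S], and the last inequality
    against [G] itself. Nonzero columns keep the denominators positive. *)
Lemma exists_rank_balanced (F : fieldType) (m n : nat) (A : 'M[F]_(m, n))
    (G : {set 'I_n}) :
  G != set0 -> (forall j, j \in G -> col j A != 0) ->
  exists S : {set 'I_n}, [/\ S \subset G, S != set0, rank_balanced A S &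
    (#|G| * \rank (col_span A S) <= #|S| * \rank A)%N].
Proof.
move=> G0 colA0.
pose rk (J : {set _}) : nat := \rank (col_span A J).
have rk_gt0 (T : {set _}) : T \subset G -> T != set0 -> (0 < rk T)%N.
  move=> /subsetP sTG /set0Pn[j jT]; rewrite lt0n mxrank_eq0.
  apply: contraNneq (colA0 _ (sTG _ jT)) => T0.
  by have := mem_col_span A jT; rewrite T0 submx0 trmx_eq0.
pose P (T : {set 'I_n}) := (T \subset G) && (T != set0).
have PG : P G by rewrite /P subxx.
pose dens (T : {set 'I_n}) : rat := #|T|%:R / (rk T)%:R.
pose S := [arg max_(T > G | P T) dens T]%O.
have [/andP[sSG S0] maxS] : P S /\ forall T, P T -> dens T <= dens S.
  by rewrite /S; case: arg_maxP.
have main (T : {set _}) : T \subset G -> (#|T| * rk S <= rk T * #|S|)%N.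
  have [->|T0 sTG] := eqVneq T set0; first by rewrite cards0.
  have := maxS T; rewrite /P sTG T0 => /(_ isT).
  rewrite /dens ler_pdivrMr ?ltr0n ?rk_gt0 // mulrAC ler_pdivlMr ?ltr0n ?rk_gt0 //.
  by rewrite -!natrM ler_nat [(rk T * _)%N]mulnC.
exists S; split=> //.
  by move=> T sTS; apply: main; apply: subset_trans sTS sSG.
apply: leq_trans (main G (subxx _)) _.
by rewrite mulnC leq_mul2l mxrank_col_span_le orbT.
Qed.

(** By balance, at most a share (d - X)/d of the columns already lie in the span of [J]; any other
    column lowers the codimension X by at least one. *)
Lemma sum_binomial_rank_le (R : realFieldType) (F : fieldType) (m n r : nat) (A : 'M[F]_(m, n))
    (S J : {set 'I_n}) (d := \rank (col_span A S))
    (X := fun K => (d - \rank (col_span A K))%N) :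
  rank_balanced A S -> J \subset S -> (0 < d)%N ->
  \sum_(j in S) ('C(X (j |: J), r))%:R <=
    #|S|%:R * (1 - r%:R / d%:R) * ('C(X J, r))%:R :> R.
Proof.
move=> balS sJS d0.
pose T := [set j in S | ((col j A)^T <= col_span A J)%MS].
have sTS : T \subset S by apply/subsetP => j; rewrite inE => /andP[].
have rkT : (\rank (col_span A T) <= \rank (col_span A J))%N.
  by apply/mxrankS/col_span_sub => j; rewrite inE => /andP[].
have rkJd : (\rank (col_span A J) <= d)%N by apply/mxrankS/col_spanS.
have cardT : (#|T| * d <= (d - X J) * #|S|)%N.
  by apply: leq_trans (balS _ sTS) _; rewrite /X subKn // leq_mul2r rkT orbT.
have XJd : (X J <= d)%N by rewrite leq_subr.
have sumS : (\sum_(j in S) 'C(X (j |: J), r) <=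
    #|T| * 'C(X J, r) + (#|S| - #|T|) * 'C((X J).-1, r))%N.
  rewrite (big_setID T) /= (setIidPr sTS) -cardsDS //.
  rewrite -!sum_nat_const; apply: leq_add; apply: leq_sum => j.
    by move=> _; apply: leq_bin2l; apply: leq_sub2l; apply/mxrankS/col_spanS/subsetUr.
  rewrite !inE => /andP[+ jS]; rewrite jS /= => /mxrank_col_span_add lt_rk.
  have ltn_predB (x y z : nat) : (x < y -> z - y <= (z - x).-1)%N by lia.
  exact/leq_bin2l/ltn_predB.
rewrite -natr_sum; move: sumS; rewrite -(ler_nat R) => /le_trans; apply.
have leTS : (#|T| <= #|S|)%N by apply: subset_leq_card.
have d0R : 0 < d%:R :> R by rewrite ltr0n.
(* This identity turns the average loss X/d times (C(X, r) - C(X - 1, r)) into exactly r/d times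
   C(X, r). *)
have binE x : (r%:R * ('C(x, r))%:R = x%:R * (('C(x, r))%:R - ('C(x.-1, r))%:R) :> R).
  case: x => [|x] /=; first by case: (r) => [|r']; rewrite ?mul0r ?bin0n ?mulr0.
  case: (r) => [|r']; first by rewrite !bin0 subrr mulr0 mul0r.
  have -> : ('C(x.+1, r'.+1))%:R - ('C(x, r'.+1))%:R = ('C(x, r'))%:R :> R.
    by rewrite binS natrD addrAC subrr add0r.
  by rewrite -!natrM -mul_bin_diag.
have -> : #|S|%:R * (1 - r%:R / d%:R) * ('C(X J, r))%:R =
    #|S|%:R * ('C(X J, r))%:R - #|S|%:R * (X J)%:R / d%:R *
      (('C(X J, r))%:R - ('C((X J).-1, r))%:R) :> R.
  rewrite (_ : #|S|%:R * (X J)%:R / d%:R * (_ - _) = #|S|%:R / d%:R *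
    ((X J)%:R * (('C(X J, r))%:R - ('C((X J).-1, r))%:R))); last by ring.
  by rewrite -binE; ring.
have : (0 : R) <= ('C(X J, r))%:R - ('C((X J).-1, r))%:R.
  by rewrite subr_ge0 ler_nat leq_bin2l // leq_pred.
have : #|S|%:R * (X J)%:R / d%:R <= #|S|%:R - #|T|%:R :> R.
  rewrite ler_pdivrMr // mulrBl lerBrDl -lerBrDr -mulrBr -natrB // -!natrM ler_nat.
  by rewrite [(#|S| * _)%N]mulnC.
rewrite natrD !natrM (natrB _ leTS) => leD leC.
have := ler_wpM2r leC leD; lra.
Qed.

(** * Drawing columns and counting the surviving zero rows *)

Lemma exists_ge_average (R : realFieldType) (T : finType) (S : {set T})
    (f : T -> R) (c : R) :
  S != set0 -> #|S|%:R * c <= \sum_(j in S) f j -> exists2 j, j \in S & c <= f j.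
Proof.
move=> /set0Pn[j0 j0S] le_c.
have [/exists_inP[j jS cf]|/exists_inPn lt_c] := boolP [exists j in S, c <= f j].
  by exists j.
suff : \sum_(j in S) f j < #|S|%:R * c by rewrite ltNge le_c.
rewrite mulr_natl -sumr_const.
rewrite (bigD1 j0) //= [ltRHS](bigD1 j0) //=.
apply: ltr_leD; first by rewrite ltNge lt_c.
by apply: ler_sum => j /andP[jS _]; rewrite ltW // ltNge lt_c.
Qed.

Definition zero_rows (F : fieldType) (m : nat) (A : 'M[F]_m) (S J : {set 'I_m}) :=
  [set i in S | [forall j in J, A i j == 0]].

(** Double counting: each zero row survives the draw of any of its at least [#|S| - s] zero
    positions in [S]. *)
Lemma sum_card_zero_rows_ge (F : fieldType) (m s : nat) (A : 'M[F]_m)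
    (S J : {set 'I_m}) :
  (forall i, i \in S -> #|[set j in S | A i j != 0%R]| <= s)%N ->
  (#|zero_rows A S J| * (#|S| - s) <= \sum_(j in S) #|zero_rows A S (j |: J)|)%N.
Proof.
move=> row_s.
have zeroE j : zero_rows A S (j |: J) = [set i in zero_rows A S J | A i j == 0].
  apply/setP => i; rewrite !inE -andbA; congr (_ && _).
  apply/forall_inP/andP => [A0|[/forall_inP A0 Aij] l].
    split; last by rewrite A0 ?setU11.
    by apply/forall_inP => l lJ; rewrite A0 // setU1r.
  by rewrite !inE => /orP[/eqP->|/A0].
under eq_bigr => j _ do rewrite zeroE -sum1dep_card.
rewrite (exchange_big_dep (fun i => i \in zero_rows A S J)) /=; last first.
  by move=> i j _ /andP[].
rewrite -sum_nat_const; apply: leq_sum => i iZ.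
have iS : i \in S by move: iZ; rewrite inE => /andP[].
move: (zero_rows A S J) iZ => Z iZ.
apply: leq_trans (leq_sub2l _ (row_s i iS)) _.
rewrite sum1dep_card -(cardsID [set j | A i j != 0] S).
rewrite -setIdE addKn; apply/subset_leq_card/subsetP => j.
by rewrite !inE negbK iZ => /andP[-> ->].
Qed.

(* Method of conditional expectations: the columns of [K] stand for [k]
   independent uniformly random columns from [S]; each draw multiplies the
   expected number of zero rows by at least [1 - s / #|S|], and the expectation
   of [C(X, r)], where [X] is the codimension of the span, by at most
   [1 - r / d]. *)
Lemma exists_cols (R : realFieldType) (F : fieldType) (m r s : nat) (A : 'M[F]_m)
    (S : {set 'I_m}) (b : R) (d := \rank (col_span A S))
    (X := fun K => (d - \rank (col_span A K))%N) :
  rank_balanced A S -> S != set0 -> (0 < d)%N -> (r <= d)%N -> (s <= #|S|)%N ->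
  (forall i, i \in S -> #|[set j in S | A i j != 0%R]| <= s)%N -> 0 <= b ->
  forall (k : nat) (J : {set 'I_m}), J \subset S -> exists2 K : {set 'I_m}, K \subset S &
    (1 - s%:R / #|S|%:R) ^+ k * #|zero_rows A S J|%:R -
      b * (1 - r%:R / d%:R) ^+ k * ('C(X J, r))%:R <=
    #|zero_rows A S K|%:R - b * ('C(X K, r))%:R.
Proof.
move=> balS S0 d0 rd sS row_s b0; elim=> [|k IHk] J sJS.
  by exists J => //; rewrite !expr0 mul1r mulr1.
have M0 : 0 < #|S|%:R :> R by rewrite ltr0n card_gt0.
have a0 : 0 <= 1 - s%:R / #|S|%:R :> R.
  by rewrite subr_ge0 ler_pdivrMr // mul1r ler_nat.
have c0 : 0 <= 1 - r%:R / d%:R :> R.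
  by rewrite subr_ge0 ler_pdivrMr ?ltr0n // mul1r ler_nat.
set a := 1 - s%:R / _ in a0 IHk *; set c := 1 - r%:R / _ in c0 IHk *.
(* [f j] is the guarantee for the remaining [k] draws once [j] is drawn; its average over [S],
   repetitions included, is at least the guarantee for [k.+1] draws. *)
pose f j : R := a ^+ k * #|zero_rows A S (j |: J)|%:R -
  b * c ^+ k * ('C(X (j |: J), r))%:R.
have [j jS le_j] : exists2 j, j \in S & a ^+ k.+1 * #|zero_rows A S J|%:R -
      b * c ^+ k.+1 * ('C(X J, r))%:R <= f j.
  apply: exists_ge_average => //; rewrite sumrB -!mulr_sumr.
  have leZ : #|S|%:R * (a * #|zero_rows A S J|%:R) <=
      \sum_(j in S) #|zero_rows A S (j |: J)|%:R.
    rewrite -natr_sum mulrA /a mulrBr mulr1 mulrCA divff ?gt_eqF // mulr1.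
    by rewrite -natrB // -natrM ler_nat mulnC sum_card_zero_rows_ge.
  have leC := sum_binomial_rank_le R r balS sJS d0.
  have := ler_wpM2l (exprn_ge0 k a0) leZ.
  have := ler_wpM2l (mulr_ge0 b0 (exprn_ge0 k c0)) leC.
  rewrite -/d -/X -/c !exprS => h1 h2.
  apply: le_trans (lerB h2 h1).
  by rewrite le_eqVlt; apply/orP; left; apply/eqP; ring.
have [|K sKS leK] := IHk (j |: J); first by rewrite subUset sub1set jS.
by exists K => //; apply: le_trans le_j leK.
Qed.

(** The columns of [S] vanishing in row [i] span a proper subspace, as column [i] does not vanish
    there. By balance they miss at least a share 1/d of [S], and at most [s] columns are missed. *)
Lemma card_balanced_le (F : fieldType) (m s : nat) (A : 'M[F]_m) (S : {set 'I_m}) :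
  rank_balanced A S -> S != set0 -> (forall i, i \in S -> A i i != 0) ->
  (forall i, i \in S -> #|[set j in S | A i j != 0%R]| <= s)%N ->
  (#|S| <= s * \rank (col_span A S))%N.
Proof.
move=> balS /set0Pn[i iS] diagA row_s.
pose T := [set j in S | A i j == 0].
have sTS : T \subset S by apply/subsetP => j; rewrite inE => /andP[].
have := @mxrank_zero_block _ _ _ 1 1 A T S (fun=> i) (fun=> i) sTS.
have -> : mxsub (fun=> i) (fun=> i) A = (A i i)%:M :> 'M[F]_1.
  by apply/matrixP => u v; rewrite !mxE !ord1 eqxx mulr1n.
rewrite -scalemx1 mxrank_scale_nz ?diagA // mxrank1 => /(_ (fun=> iS)) rkT.
have {}rkT : (1 + \rank (col_span A T) <= \rank (col_span A S))%N.
  by apply: rkT => t j; rewrite inE => /andP[_ /eqP].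
have cardS : #|S| = (#|[set j in S | A i j != 0%R]| + #|T|)%N.
  rewrite -(cardsID [set j | A i j != 0] S) -setIdE; congr (_ + #|pred_of_set _|)%N.
  by apply/setP => j; rewrite !inE negbK andbC.
have := balS T sTS; have := row_s i iS; rewrite cardS; nia.
Qed.

(** * Estimates for the sampling argument *)

(** C(d, r)(r/d)^r is one term of the expansion of (1 + r/d)^d, which is at most e^r. *)
Lemma bin_le_expR (R : realType) (d r : nat) :
  (0 < r)%N -> (r <= d)%N ->
  ('C(d, r))%:R <= expR (r%:R * (1 + ln (d%:R / r%:R))) :> R.
Proof.
move=> r0 rd.
have d0 : (0 < d)%N by apply: leq_trans rd.
have r0R : 0 < r%:R :> R by rewrite ltr0n.
have d0R : 0 < d%:R :> R by rewrite ltr0n.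
have x0 : 0 < d%:R / r%:R :> R by rewrite divr_gt0.
rewrite mulrDr mulr1 expRD expRM_natl lnK ?posrE // -ler_pdivrMr ?exprn_gt0 //.
rewrite -exprVn invf_div.
apply: (@le_trans _ _ ((1 + r%:R / d%:R) ^+ d)).
  rewrite exprDn (bigD1 (Ordinal (rd : (r < d.+1)%N))) //= expr1n mul1r [leLHS]mulr_natl.
  by rewrite lerDl sumr_ge0.
have -> : expR r%:R = expR (r%:R / d%:R) ^+ d :> R.
  by rewrite -expRM_natl mulrCA divff ?mulr1 // gt_eqF.
by rewrite lerXn2r ?nnegrE ?expR_ge0 ?expR_ge1Dx //.
Qed.

Lemma coupon_tail_le (R : realType) (d r k : nat) :
  (0 < r)%N -> (r <= d)%N -> d%:R * (ln (d%:R / r%:R) + 3) <= k%:R :> R ->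
  ('C(d, r))%:R * (1 - r%:R / d%:R) ^+ k <= expR (- (2 * r%:R)) :> R.
Proof.
move=> r0 rd le_k.
have d0R : 0 < d%:R :> R by rewrite ltr0n (leq_trans r0).
have r0R : 0 < r%:R :> R by rewrite ltr0n.
have c0 : 0 <= 1 - r%:R / d%:R :> R by rewrite subr_ge0 ler_pdivrMr // mul1r ler_nat.
have : (1 - r%:R / d%:R) ^+ k <= expR (- (r%:R * (ln (d%:R / r%:R) + 3))) :> R.
  apply: (@le_trans _ _ (expR (- (r%:R / d%:R)) ^+ k)).
    by rewrite lerXn2r ?nnegrE ?expR_ge0 // expR_ge1Dx.
  rewrite -expRM_natl ler_expR mulrN lerN2 mulrCA ler_wpM2l ?(ltW r0R) //.
  by rewrite ler_pdivlMr // mulrC.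
move=> /(ler_pM _ _ (bin_le_expR R r0 rd)) => le_b.
apply: le_trans (le_b _ _) _; rewrite ?ler0n ?exprn_ge0 //.
by rewrite -expRD ler_expR; lra.
Qed.

Lemma expR_N2_le_oneB (R : realType) (x : R) :
  0 <= x -> x <= 1 / 2 -> expR (- (2 * x)) <= 1 - x.
Proof.
move=> x0 x2; have x1 : 0 < 1 - x by lra.
rewrite expRN -[leRHS]invrK lef_pV2 ?posrE ?expR_gt0 ?invr_gt0 //.
apply: le_trans (expR_ge1Dx (2 * x)).
by rewrite -[leLHS]mul1r ler_pdivrMr //; nra.
Qed.

Lemma ln2_ge_half (R : realType) : 1 / 2 <= ln 2 :> R.
Proof.
rewrite -[leLHS]expRK ler_ln ?posrE ?expR_gt0 //.
rewrite -[leLHS]invrK -expRN invf_ple ?posrE ?invr_gt0 ?expR_gt0 //.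
by apply: le_trans (expR_ge1Dx _); lra.
Qed.

Lemma expR1_ge2 (R : realType) : 2 <= expR 1 :> R.
Proof. by apply: le_trans (expR_ge1Dx 1); lra. Qed.

Lemma expn16_le_expR (R : realType) (r : nat) (x : R) :
  4 * r%:R <= x -> (16 ^ r)%:R <= expR x :> R.
Proof.
move=> rx; apply: (@le_trans _ _ (expR (4 * r%:R))); last by rewrite ler_expR.
rewrite expRM_natr natrX lerXn2r ?nnegrE ?expR_ge0 //.
have -> : 4 = 4%:R * 1 :> R by rewrite mulr1.
rewrite expRM_natl -[16%:R]/((2 ^ 4)%:R) natrX lerXn2r ?nnegrE ?expR_ge0 //.
exact: expR1_ge2.
Qed.

(** Take r about l/8, so that 16^r <= e^(l/2), and k about d(ln(d/r) + 3), just enough for the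
    coupon tail. A row then survives with probability at least e^(-l/32), while the tail is at most
    e^(-l/8). *)
Lemma sampling_parameters (R : realType) (M d s : nat) (l : R) :
  expR l = M%:R -> 16 <= l -> (0 < d)%N ->
  1000 * (s%:R * (d%:R * ln (2 + d%:R / l))) < M%:R * l ->
  exists r : nat, [/\ (0 < r)%N, (16 ^ r <= M)%N &
    (r <= d)%N -> (s <= M)%N /\ exists k : nat,
      (16 ^ r)%:R <= M%:R * ((1 - s%:R / M%:R) ^+ k -
                             ('C(d, r))%:R * (1 - r%:R / d%:R) ^+ k) :> R].
Proof.
move=> expl l16 d0 lt_s.
have l0 : 0 < l by lra.
have M0 : 0 < M%:R :> R by rewrite -expl expR_gt0.
have d0R : 0 < d%:R :> R by rewrite ltr0n.
pose r := Num.truncn (l / 8); exists r.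
have /andP[r_le r_gt] : r%:R <= l / 8 < r.+1%:R by rewrite truncn_itv //; lra.
have {}r_gt : l / 16 <= r%:R by move: r_gt; rewrite -(natr1 r); lra.
have r0 : (0 < r)%N by rewrite -(ltr0n R); lra.
have r0R : 0 < r%:R :> R by rewrite ltr0n.
have le16 : (16 ^ r)%:R <= expR (l / 2) by apply: expn16_le_expR; lra.
move: (r) r_le r_gt r0 r0R le16 => {}r r_le r_gt r0 r0R le16.
split=> // [|rd].
  by rewrite -(ler_nat R) -expl (le_trans le16) // ler_expR; lra.
have [L LE] : exists L : R, L = ln (2 + d%:R / l) by eexists.
have t0 : 0 < d%:R / l by rewrite divr_gt0.
have rdR : r%:R <= d%:R :> R by rewrite ler_nat.
have L2 : ln 2 <= L.
  by rewrite LE ler_ln ?posrE //; lra.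
have L_half : 1 / 2 <= L by apply: le_trans (ln2_ge_half R) L2.
(* From r >= l/16, d/r is at most 2^4 (2 + d/l), and ln 2 <= L. *)
have lndr : ln (d%:R / r%:R) <= 5 * L :> R.
  have -> : 5 * L = 4%:R * L + L by ring.
  rewrite {2}LE.
  apply: (@le_trans _ _ (ln ((2 ^+ 4) * (2 + d%:R / l)))).
    rewrite ler_ln ?posrE ?divr_gt0 //; last lra.
    have : d%:R / r%:R <= 16 * (d%:R / l).
      rewrite ler_pdivrMr // (_ : 16 * _ * _ = 16 * d%:R * r%:R / l); last by ring.
      by rewrite ler_pdivlMr //; nra.
    by lra.
  rewrite lnM ?posrE //; last lra.
  by rewrite lnXn // lerD2r -[ln 2 *+ _]mulr_natl ler_wpM2l.
have lndr0 : 0 <= ln (d%:R / r%:R) :> R.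
  by rewrite ln_ge0 // ler_pdivlMr // mul1r.
pose y : R := d%:R * (ln (d%:R / r%:R) + 3).
have y0 : 0 <= y by rewrite mulr_ge0 //; lra.
have [k kE] : exists k, k = (Num.truncn y).+1 by eexists.
have y_le : y <= k%:R by rewrite kE ltW // truncnS_gt.
(* With L >= 1/2 and d >= 1, the terms 5L, 3 <= 6L and the rounding 1 <= 2dL add up to 13. *)
have k_le : k%:R <= 13 * (d%:R * L).
  have : (Num.truncn y)%:R <= y by rewrite truncn_le.
  have : 1 <= d%:R :> R by rewrite ler1n.
 
  by rewrite kE -(natr1 (Num.truncn y)) /y; nra.
have [x xE] : exists x : R, x = s%:R / M%:R by eexists.
have x0 : 0 <= x by rewrite xE divr_ge0.
have sE : s%:R = x * M%:R by rewrite xE divfK // gt_eqF.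
have lt_x : 1000 * (x * (d%:R * L)) < l.
  by rewrite -(ltr_pM2r M0); move: lt_s; rewrite -LE sE; lra.
have x_half : x <= 1 / 2.
  have : l / 16 * (1 / 2) <= d%:R * L by rewrite ler_pM //; lra.
  by nra.
split; first by rewrite -(ler_nat R) sE; nra.
exists k; rewrite -xE.
have lea : expR (- (l / 32)) <= (1 - x) ^+ k.
  apply: (@le_trans _ _ (expR (- (2 * x)) ^+ k)).
    by rewrite -expRM_natl ler_expR; nra.
  rewrite lerXn2r ?nnegrE ?expR_ge0 ?expR_N2_le_oneB //; lra.
have leb : ('C(d, r))%:R * (1 - r%:R / d%:R) ^+ k <= expR (- (l / 8)).
  by apply: le_trans (coupon_tail_le r0 rd y_le) _; rewrite ler_expR; lra.
have gap : 2 * expR (- (l / 8)) <= expR (- (l / 32)).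
  have -> : - (l / 32) = 3 / 32 * l + - (l / 8) by field.
  rewrite expRD ler_wpM2r ?expR_ge0 //.
  by apply: le_trans (expR_ge1Dx _); lra.
apply: le_trans le16 _; apply: (@le_trans _ _ (M%:R * expR (- (l / 8)))).
  by rewrite -expl -expRD ler_expR; lra.
by rewrite ler_wpM2l ?(ltW M0) //; lra.
Qed.

(** * Counting nonzero entries *)

Lemma balanced_row_density (R : realType) (N s : nat) (A : 'M[R]_N) (S : {set 'I_N})
    (d := \rank (col_span A S)) (l := ln (#|S|%:R : R)) :
  (forall i j, `|A i j - (i == j)%:R| <= 1 / 3) -> rank_balanced A S ->
  (forall i, i \in S -> #|[set j in S | A i j != 0%R]| <= s)%N -> 16 <= l -> (0 < d)%N ->
  #|S|%:R * l <= 1000 * (s%:R * (d%:R * ln (2 + d%:R / l))).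
Proof.
move=> nearA balS row_s l16 d0.
have S0 : S != set0.
  by apply: contraTneq l16 => S0; rewrite /l S0 cards0 ln0 // -ltNge.
have expl : expR l = #|S|%:R by rewrite lnK // posrE ltr0n card_gt0.
rewrite leNgt; apply/negP => /(sampling_parameters expl l16 d0)[r [r0 le16 rdP]].
have small (J : {set 'I_N}) : J \subset S -> (d - \rank (col_span A J) <= r)%N ->
    (#|zero_rows A S J| < 16 ^ r)%N.
  move=> sJS rkJ; pose f := @enum_val _ (mem (zero_rows A S J)).
  apply: (@near_identity_size_lt _ _ _ (mxsub f f A)) => //.
    by move=> i j; rewrite mxE -(inj_eq enum_val_inj).
  have fZ t : f t \in zero_rows A S J by apply: enum_valP.
  apply: leq_trans rkJ; rewrite -(leq_add2r (\rank (col_span A J))).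
  rewrite subnK; last by apply/mxrankS/col_spanS.
  apply: mxrank_zero_block => // [t|t j jJ].
    by have := fZ t; rewrite inE => /andP[].
  by have := fZ t; rewrite inE => /andP[_ /forall_inP/(_ _ jJ)/eqP].
have zeroS : zero_rows A S set0 = S.
  apply/setP => i; rewrite inE andb_idr // => _.
  by apply/forall_inP => j; rewrite inE.
have span0 : \rank (col_span A set0) = 0%N.
  by rewrite /col_span big_set0 mxrank0.
have [rd|dr] := leqP r d; last first.
  have := small set0 (sub0set _); rewrite span0 subn0 zeroS => /(_ (ltnW dr)).
  by rewrite ltnNge le16.
have [sS [k le_k]] := rdP rd.
(* With penalty weight [#|S|], a single violation C(X, r) >= 1 outweighs all zero rows, so a
   positive value forces X < r. *)
have [K sKS] := exists_cols balS S0 d0 rd sS row_s (ler0n R #|S|) k (sub0set S).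
rewrite zeroS span0 subn0 -/d => leK.
have {leK}leK : (16 ^ r)%:R <= #|zero_rows A S K|%:R -
    #|S|%:R * ('C(d - \rank (col_span A K), r))%:R :> R.
  apply: le_trans leK; apply: le_trans le_k _.
  by rewrite le_eqVlt; apply/orP; left; apply/eqP; ring.
have [rX|Xr] := leqP r (d - \rank (col_span A K)).
  have leZ : (#|zero_rows A S K| <= #|S| * 'C(d - \rank (col_span A K), r))%N.
    apply: (@leq_trans #|S|); last by rewrite leq_pmulr // bin_gt0.
    by apply/subset_leq_card/subsetP => i; rewrite inE => /andP[].
  move: leK; rewrite leNgt => /negP[]; rewrite (@le_lt_trans _ _ 0) ?ltr0n ?expn_gt0 //.
  by rewrite subr_le0 -natrM ler_nat.
move: leK; rewrite bin_small // mulr0 subr0 ler_nat leqNgt.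
by rewrite small // ltnW.
Qed.

(** Markov's inequality: at most half of the rows exceed twice the average. *)
Lemma card_sparse_rows (N : nat) (c : 'I_N -> nat) (Z := (\sum_i c i)%N) :
  (0 < Z)%N -> (N <= 2 * #|[set i | (c i <= (2 * Z) %/ N)%N]|)%N.
Proof.
move=> Z0; have [N0|N0] := posnP N; first by rewrite [leqLHS]N0.
set G := [set i | _].
have : (#|~: G| * (2 * Z) <= N * Z)%N.
  rewrite -sum_nat_const [leqRHS]mulnC.
  apply: (@leq_trans (\sum_(i in ~: G) c i * N)).
    by apply: leq_sum => i; rewrite !inE -ltnNge ltn_divLR // => /ltnW.
  rewrite -big_distrl leq_mul2r /Z /= [leqRHS](bigID (mem (~: G))) /=.
  by rewrite leq_addr orbT.
have := cardsC G; rewrite card_ord; nia.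
Qed.

Lemma card_nonzero_entries (R : realType) (N : nat) (A : 'M[R]_N) :
  #|[set ij : 'I_N * 'I_N | A ij.1 ij.2 != 0]| =
    (\sum_i #|[set j | A i j != 0%R]|)%N.
Proof.
rewrite -sum1dep_card; under [RHS]eq_bigr do rewrite -sum1dep_card.
by rewrite pair_big_dep.
Qed.

(** Factor e^(x/2) as e^(x/8) e^(x/8) e^(x/4); the last two factors absorb the divisor 2x. *)
Lemma ln_shift_ge (R : realType) (x y : R) :
  32 <= x -> expR (x / 2) <= 2 * y -> x / 8 <= ln (2 + y / x).
Proof.
move=> x32 le_y; have x0 : 0 < x by lra.
have y0 : 0 < y by have := expR_gt0 (x / 2); lra.
have yx0 : 0 < y / x by rewrite divr_gt0.
rewrite -[leLHS]expRK ler_ln ?posrE ?expR_gt0 //; last lra.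
suff : expR (x / 8) <= y / x by lra.
rewrite ler_pdivlMr //.
have e8 : 8 <= expR (x / 8).
  apply: (@le_trans _ _ (16 ^ 1)%:R); first by rewrite expn1 ler_nat.
  by apply: expn16_le_expR; lra.
have e4 : x / 4 <= expR (x / 4) by apply: le_trans (expR_ge1Dx _); lra.
have e2 : expR (x / 2) = expR (x / 8) * expR (x / 8) * expR (x / 4).
  by rewrite -!expRD; congr expR; field.
have : 8 * (x / 4) <= expR (x / 8) * expR (x / 4) by rewrite ler_pM //; lra.
move=> /(ler_wpM2l (expR_ge0 (x / 8))); rewrite [leRHS]mulrA -e2; lra.
Qed.

Lemma ln_add2_le_double (R : realType) (y : R) :
  0 <= y -> ln (2 + 2 * y) <= 2 * ln (2 + y).
Proof.
move=> y0; have y2 : 0 < 2 + y by lra.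
rewrite [leRHS]mulr_natl -lnXn // ler_ln ?posrE ?exprn_gt0 //; last lra.
by rewrite expr2; nra.
Qed.

(** If M >= sqrt(N) and N is large, the hypothesis on [l] transfers with [l >= L / 2]. Otherwise L
    is at most a constant times W, and N <= 2sn already suffices. *)
Lemma sparsity_comparison (R : realType) (N M n d s : nat)
    (L := ln (N%:R : R)) (l := ln (M%:R : R)) :
  (2 <= N)%N -> (0 < M)%N -> (0 < d)%N -> (d <= n)%N ->
  (N * d <= 2 * (M * n))%N -> (M <= s * d)%N ->
  (16 <= l -> M%:R * l <= 1000 * (s%:R * (d%:R * ln (2 + d%:R / l)))) ->
  N%:R * L <= 8000 * (s%:R * (n%:R * ln (2 + n%:R / L))).
Proof.
move=> N2 M0 d0 dn Nd Md main.
have N0R : 0 < N%:R :> R by rewrite ltr0n ltnW.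
have L0 : 0 < L by rewrite ln_gt0 // ltr1n.
have M0R : 0 < M%:R :> R by rewrite ltr0n.
have d0R : 0 < d%:R :> R by rewrite ltr0n.
have dnR : d%:R <= n%:R :> R by rewrite ler_nat.
have n0R : 0 < n%:R :> R by lra.
have NdR : N%:R * d%:R <= 2 * (M%:R * n%:R) :> R by rewrite -!natrM ler_nat.
have nL0 : 0 < n%:R / L by rewrite divr_gt0.
set W := ln (2 + n%:R / L).
have W_half : 1 / 2 <= W.
  by apply: le_trans (ln2_ge_half R) _; rewrite ler_ln ?posrE //; lra.
have [/andP[L32 lL]|small] := boolP ((32 <= L) && (L / 2 <= l)).
  have l16 : 16 <= l by lra.
  have l0 : 0 < l by lra.
  have le_W : ln (2 + d%:R / l) <= 2 * W.
    apply: le_trans (ln_add2_le_double (ltW nL0)).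
    have dl0 : 0 < d%:R / l by rewrite divr_gt0.
    rewrite ler_ln ?posrE; [rewrite lerD2l|lra..].
    have -> : 2 * (n%:R / L) = n%:R / (L / 2) by field; rewrite gt_eqF.
    by rewrite ler_pM ?invr_ge0 ?(ltW d0R) ?(ltW l0) // lef_pV2 ?posrE //; lra.
  have {}main := main l16.
  rewrite -(ler_pM2r d0R).
  have h1 : N%:R * d%:R * l <= 2 * (M%:R * n%:R) * l by rewrite ler_wpM2r // ltW.
  have h2 : n%:R * (M%:R * l) <= n%:R * (1000 * (s%:R * (d%:R * ln (2 + d%:R / l)))).
    by rewrite ler_wpM2l // ltW.
  have h3 : n%:R * s%:R * d%:R * ln (2 + d%:R / l) <= n%:R * s%:R * d%:R * (2 * W).
    by rewrite ler_wpM2l // !mulr_ge0 // ltW.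
  have h4 : N%:R * d%:R * (L / 2) <= N%:R * d%:R * l.
    by rewrite ler_wpM2l // mulr_ge0 // ltW.
  lra.
have N_le : N%:R <= 2 * (s%:R * n%:R) :> R.
  rewrite -!natrM ler_nat -(leq_pmul2r d0); apply: leq_trans Nd _.
  by rewrite -!mulnA leq_mul2l /= [(n * d)%N]mulnC mulnA leq_mul2r Md orbT.
have L_le : L <= 4000 * W.
  have [L32|L32] := ltrP L 32; first by lra.
  move: small; rewrite L32 /= -ltNge => lL.
  suff : L / 8 <= W by lra.
  apply: ln_shift_ge => //.
  (* As M < sqrt(N) and d >= 1, the inequality Nd <= 2Mn forces sqrt(N) <= 2n, so n is exponentially
     large in L. *)
  rewrite -(ler_pM2r d0R).
  have M_le : M%:R <= expR (L / 2).
    by rewrite -[leLHS]lnK ?posrE // ler_expR ltW.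
  have NE : N%:R = expR (L / 2) * expR (L / 2).
    by rewrite -expRD -splitr lnK // posrE.
  rewrite -(ler_pM2l (expR_gt0 (L / 2))).
  have : expR (L / 2) * n%:R * 1 <= expR (L / 2) * n%:R * d%:R.
    by rewrite ler_wpM2l ?mulr_ge0 ?expR_ge0 ?(ltW n0R) // ler1n.
  have : M%:R * n%:R <= expR (L / 2) * n%:R by rewrite ler_wpM2r // ltW.
  by move: NdR; rewrite NE; lra.
have : N%:R * L <= 2 * (s%:R * n%:R) * (4000 * W) by rewrite ler_pM ?(ltW N0R) ?(ltW L0).
lra.
Qed.

Theorem corollary2 (R : realType) :
  exists c : R, 0 < c /\
    forall (N n : nat) (A : 'M[R]_N),
      (2 <= N)%N ->
      \rank A = n ->
      (forall i j : 'I_N, `|A i j - (i == j)%:R| <= 1 / 3) ->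
      c * (ln N%:R / (n%:R * ln (2 + n%:R / ln N%:R))) <= nonzero_density A.
Proof.
(* The constant 8000 of [sparsity_comparison], doubled because [s] is up to twice the average row
   count. *)
exists (1 / 16000); split; first by lra.
move=> N n A N2 rkA nearA.
have N0 : (0 < N)%N by apply: ltnW.
have N0R : 0 < N%:R :> R by rewrite ltr0n.
have L0 : 0 < ln (N%:R : R) by rewrite ln_gt0 // ltr1n.
have diagA i : A i i != 0.
  apply/eqP => Aii; have := nearA i i.
  by rewrite Aii eqxx sub0r normrN normr1; lra.
pose c i := #|[set j | A i j != 0%R]|.
pose Z := (\sum_i c i)%N; pose s := ((2 * Z) %/ N)%N.
pose G := [set i | (c i <= s)%N].
have Z0 : (0 < Z)%N.
  rewrite /Z (bigD1 (Ordinal N0)) //= ltn_addr // card_gt0.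
  by apply/set0Pn; exists (Ordinal N0); rewrite inE.
have NG : (N <= 2 * #|G|)%N by apply: card_sparse_rows.
have G0 : G != set0 by rewrite -card_gt0; move: NG N0; lia.
have colA0 j : j \in G -> col j A != 0.
  move=> _; apply: contraNneq (diagA j) => /colP/(_ j).
  by rewrite !mxE => ->.
have [S [sSG S0 balS rkS]] := exists_rank_balanced G0 colA0.
have row_s i : i \in S -> (#|[set j in S | A i j != 0%R]| <= s)%N.
  move=> /(subsetP sSG); rewrite inE; apply: leq_trans.
  by apply/subset_leq_card/subsetP => j; rewrite !inE => /andP[].
have Sd : (#|S| <= s * \rank (col_span A S))%N by apply: card_balanced_le.
have S_gt0 : (0 < #|S|)%N by rewrite card_gt0.
have d0 : (0 < \rank (col_span A S))%N.
  by move: Sd S_gt0; case: (\rank _) => //; rewrite muln0; lia.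
have dn : (\rank (col_span A S) <= n)%N by rewrite -rkA mxrank_col_span_le.
have Nd : (N * \rank (col_span A S) <= 2 * (#|S| * n))%N.
  rewrite -rkA; apply: leq_trans (leq_mul NG (leqnn _)) _.
  by rewrite -mulnA leq_mul2l rkS.
have := sparsity_comparison N2 S_gt0 d0 dn Nd Sd
  (fun l16 => balanced_row_density nearA balS row_s l16 d0).
have n0R : 0 < n%:R :> R by rewrite ltr0n (leq_trans d0).
set W := ln (2 + _) => le_sW.
have W0 : 0 < W.
  by rewrite ln_gt0 // (@lt_le_trans _ _ 2) ?ltr1n // lerDl divr_ge0 ?ltW.
have sZ : s%:R * N%:R <= 2 * Z%:R :> R by rewrite -!natrM ler_nat leq_trunc_div.
rewrite /nonzero_density card_nonzero_entries -/Z.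
rewrite ler_pdivlMr ?exprn_gt0 // mulrA mulrAC ler_pdivrMr ?mulr_gt0 //.
have h1 := ler_wpM2r (ltW N0R) le_sW.
have h2 := ler_wpM2r (ltW (mulr_gt0 n0R W0)) sZ.
rewrite expr2; lra.
Qed.
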